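(* Consider a network of $n$ links with a conflict graph that is $C$-independent for a constant $C=O(1)$, in which each link runs an (arbitrary) learning algorithm choosing between the actions ''send'' and ''not send'' once per phase of length $k=T'$, with the utility function $u$ described below. Every sequence of action vectors whose average regret per phase is $\epsilon\le\frac{1}{4n}$ for all links yields an $O(1/\delta)$-approximation of the average optimum against individual $(T',1-\delta)$-bounded adversaries.
   Context: A network consists of a set $V$ of $n$ links; time steps are synchronized, one channel. Conflict graph: weights $b_u(v)\ge0$; if a set $L$ transmits in a step, $v\in L$ succeeds iff the step is not jammed for $v$ and $\sum_{u\in L}b_u(v)\le1$. A set is feasible if all its links can succeed simultaneously; the graph is $C$-independent if every feasible $L$ contains $L'$ with $|L'|=\Omega(|L|)$ and $\sum_{v\in L'}b_u(v)\le C$ for all $u\in V$. An individual $(T',1-\delta)$-bounded adversary decides for each link separately which steps are jammed for it, jamming for each link at most a $(1-\delta)$-fraction of the steps in any window of $T'$ or more consecutive steps; a jammed transmission fails. Links only observe success/failure of their own transmissions. Each link partitions time into phases of $T'$ consecutive steps (not necessarily aligned across links) and in each phase either transmits in every step or in none. After phase $R$, with $w^R_i$ the fraction of successful time steps of link $i$ in $R$, the utility is $u_i^{(R)}=1$ if $i$ transmits and $w^R_i\ge\frac12\delta$; $u_i^{(R)}=-1$ if $i$ transmits and $w^R_i<\frac12\delta$; $u_i^{(R)}=0$ if $i$ does not transmit. The average regret per phase of link $i$ is $\frac{1}{|\mathcal R_i|}\left(\max_{a\in\{\text{send},\text{not send}\}}\sum_R u_i^{(R)}(a)-\sum_R u_i^{(R)}(a_i^{(R)})\right)$,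 where $\mathcal R_i$ is the set of phases, $a_i^{(R)}$ the chosen actions, and $u_i^{(R)}(a)$ the utility $i$ would have obtained by playing $a$ in $R$ with the other links' actions unchanged. The optimum in a time step is a maximum-cardinality set of non-jammed links that can succeed simultaneously; an approximation factor $\rho$ means the average optimum over time steps is at most $\rho$ times the average number of successful transmissions per time step.
   Formalization: The formal statement assumes that no link interferes with itself, b_v(v) = 0; with self-weights close to 1 the claim fails. Time is a finite run in which each link completes at least one phase and is silent outside its complete phases. *)

(* Defs.v *)
(* Mathematical Components world. *)
From mathcomp Require Import all_boot all_order all_algebra.

Set Implicit Arguments.
Unset Strict Implicit.
Unset Printing Implicit Defensive.

Import Order.TTheory GRing.Theory Num.Theory.
Local Open Scope ring_scope.

(* [weight b u v] is b_u(v), the interference that u causes at v. A conflict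
   graph has no loops: a link does not interfere with itself. *)
Record conflict_graph (R : realFieldType) (V : finType) := ConflictGraph {
  weight :> V -> V -> R;
  weight_ge0 : forall u v, 0 <= weight u v;
  weight_loop : forall v, weight v v = 0 }.

Definition interference_ok (R : realFieldType) (V : finType)
    (b : conflict_graph R V) (L : {set V}) (v : V) : bool :=
  \sum_(u in L) b u v <= 1.

Definition feasible (R : realFieldType) (V : finType)
    (b : conflict_graph R V) (L : {set V}) : bool :=
  [forall v in L, interference_ok b L v].

(* [c] is the constant hidden in |L'| = Omega(|L|). *)
Definition C_independent (R : realFieldType) (V : finType)
    (b : conflict_graph R V) (C c : R) : Prop :=
  forall L : {set V}, feasible b L ->
    exists L' : {set V},
      [/\ L' \subset L,
          c * #|L|%:R <= #|L'|%:R
        & forall u : V, \sum_(v in L') b u v <= C].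

(* A finite run over the time steps 0, ..., horizon - 1. The phase number j of
   link i consists of the [phase_len] steps starting at
   offset i + j * phase_len, and [send i j] tells whether i transmits in all of
   these steps or in none. [jammed i t] tells whether step t is jammed for i. *)
Record run (V : finType) := Run {
  phase_len : nat;
  horizon : nat;
  offset : V -> nat;
  jammed : V -> nat -> bool;
  send : V -> nat -> bool }.

Section Run.
Variables (R : realFieldType) (V : finType) (b : conflict_graph R V).
Implicit Types (r : run V) (i v : V) (j t : nat) (x : bool) (L : {set V}).

(* Number of phases of i that are completed within the horizon. *)
Definition num_phases r i : nat := ((horizon r - offset r i) %/ phase_len r)%N.

Definition phase_start r i j : nat := (offset r i + j * phase_len r)%N.

(* Links are silent in the incomplete phases at both ends of the run. *)
Definition transmitting r t : {set V} :=
  [set i | [exists j : 'I_(num_phases r i),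
     send r i j && (phase_start r i j <= t < phase_start r i j + phase_len r)%N]].

Definition succeeds r L v t : bool :=
  [&& v \in L, ~~ jammed r v t & interference_ok b L v].

Definition success_fraction r i j : R :=
  (\sum_(phase_start r i j <= t < phase_start r i j + phase_len r)
     succeeds r (transmitting r t) i t)%N%:R / (phase_len r)%:R.

Definition utility (delta : R) r i j : R :=
  if send r i j
  then if delta / 2 <= success_fraction r i j then 1 else -1
  else 0.

(* The same run, except that i plays [x] in its phase j. *)
Definition deviate r i j x : run V :=
  Run (phase_len r) (horizon r) (offset r) (jammed r)
      (fun i' j' => if (i' == i) && (j' == j) then x else send r i' j').

Definition average_regret (delta : R) r i : R :=
  (Num.max (\sum_(j < num_phases r i) utility delta (deviate r i j true) i j)
           (\sum_(j < num_phases r i) utility delta (deviate r i j false) i j)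
   - \sum_(j < num_phases r i) utility delta r i j) / (num_phases r i)%:R.

(* Individual (T', 1 - delta)-bounded adversary. *)
Definition bounded_adversary (T' : nat) (delta : R) r : Prop :=
  forall (v : V) (s w : nat), (T' <= w)%N -> (s + w <= horizon r)%N ->
    (\sum_(s <= t < s + w) jammed r v t)%N%:R <= (1 - delta) * w%:R.

Definition optimum r t : nat :=
  \max_(L : {set V} | [forall v in L, succeeds r L v t]) #|L|.

Definition average_optimum r : R :=
  (\sum_(t < horizon r) optimum r t)%N%:R / (horizon r)%:R.

Definition average_successes r : R :=
  (\sum_(t < horizon r)
     #|[set v | succeeds r (transmitting r t) v t]|)%N%:R / (horizon r)%:R.

End Run.

(* Main.v *)
Require Import Defs.
From mathcomp Require Import all_boot all_order all_algebra.
From mathcomp Require Import zify ring lra.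

Set Implicit Arguments.
Unset Strict Implicit.
Unset Printing Implicit Defensive.

Import Order.TTheory GRing.Theory Num.Theory.
Local Open Scope ring_scope.

(* The optimum of every step is at most |O| for a largest feasible set O, so it
   suffices to bound |O| times the horizon by the number of successes. Low regret
   means that a link sends, or else is silent in a phase where sending would
   fail, in a constant fraction of its phases. Jamming leaves a fraction delta of
   each phase, so a failure forces at least one step whose interference exceeds
   1. Interferers send in whole phases, and a phase of one link meets at most two
   phases of another. Hence C-independence shows, without losing a factor delta,
   that the number X of sending phases is Omega(|O|) times the number of phases
   per link.
   Let G be the number of sending phases that reach utility 1. Low regret gives
   X <= 2G + N/4, where N is the largest number of phases of a link. This is
   useless when X is below N/4, so G >= N/56 is needed as well. Each failed
   sending phase collides with another one, so it occupies on average at most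
   3/2, not 2, phases of a given link; as about N/2 of these must be occupied,
   3/2 * N/4 < N/2 leaves a constant fraction of N to the successful ones. *)

(** * Phases of different links and how they overlap *)

Section Timing.
Variables (V : finType) (r : run V).
Implicit Types (u v : V) (t j p : nat).

Definition in_phase v j t : bool :=
  (phase_start r v j <= t < phase_start r v j + phase_len r)%N.

Definition sends v := (\sum_(j < num_phases r v) send r v j)%N.

Lemma mem_transmitting v j t :
  (j < num_phases r v)%N -> send r v j -> in_phase v j t ->
  v \in transmitting r t.
Proof.
move=> jN sj tj; rewrite inE; apply/existsP; exists (Ordinal jN).
by rewrite /= sj.
Qed.

Lemma transmittingP v t : v \in transmitting r t ->
  exists2 j : 'I_(num_phases r v), send r v j & in_phase v j t.
Proof. by rewrite inE => /existsP[j /andP[sj tj]]; exists j. Qed.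

Lemma transmitting_deviate v j t :
  (j < num_phases r v)%N -> in_phase v j t ->
  transmitting (deviate r v j true) t = v |: transmitting r t.
Proof.
move=> jN tj; apply/setP => u; rewrite !inE.
have [->|uv] := eqVneq u v.
  by apply/existsP; exists (Ordinal jN); rewrite /= !eqxx.
by apply: eq_existsb => j' /=; rewrite (negPf uv).
Qed.

(* Shifted by one, so that [(cell v t).-1] is the phase of [v] containing [t]
   and the steps before the first phase get cell 0. *)
Definition cell v t : nat := ((t + phase_len r - offset r v) %/ phase_len r)%N.

(* A phase of length T of [u] intersects at most these two cells of [v]. *)
Definition meets v u j p : bool :=
  (p == cell v (phase_start r u j)) || (p == (cell v (phase_start r u j)).+1).

(** The weight [f] is 1 when only the two cells are counted, and a load-dependent share in
    [busy_le]. *)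
Lemma sum_meets v u j M (f : nat -> nat) :
  (\sum_(i < M) meets v u j i.+1 * f i.+1 <=
   f (cell v (phase_start r u j)) + f (cell v (phase_start r u j)).+1)%N.
Proof.
set p := cell _ _.
have one q : (\sum_(i < M) (i.+1 == q) * f i.+1 <= f q)%N.
  case: q => [|q].
    by rewrite big1 // => i _; rewrite eqn0Ngt.
  have [qM|qM] := ltnP q M.
    rewrite (bigD1 (Ordinal qM)) //= eqxx mul1n big1 ?addn0 // => i.
    by rewrite -val_eqE eqSS /= => /negPf->.
  by rewrite big1 // => i _; rewrite eqSS ltn_eqF // (leq_trans (ltn_ord i)).
apply: leq_trans (leq_add (one p) (one p.+1)); rewrite -big_split /=.
apply: leq_sum => i _; rewrite /meets -/p -mulnDl leq_mul2r.
by apply/orP; right; do 2 case: eqP.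
Qed.

(** Phases of [v] itself count too. A phase aligned with the cells of [v] is still charged to two of
    them, which is harmless for upper bounds. *)
Definition load v p : nat :=
  (\sum_u \sum_(j < num_phases r u | send r u j) meets v u j p)%N.

Lemma load_ge1 v u (j : 'I_(num_phases r u)) (p : nat) :
  send r u j -> meets v u j p -> (0 < load v p)%N.
Proof.
by move=> sj m; rewrite /load (bigD1 u) //= (bigD1 j) //= m.
Qed.

Lemma load_ge2 v u w (j : 'I_(num_phases r u)) (k : 'I_(num_phases r w))
    (p : nat) :
  u != w -> send r u j -> send r w k -> meets v u j p -> meets v w k p ->
  (1 < load v p)%N.
Proof.
move=> uw sj sk mj mk; rewrite /load (bigD1 u) //= (bigD1 j) //= mj.
rewrite (bigD1 w) 1?eq_sym //= (bigD1 k) //= mk; lia.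
Qed.

Lemma sum_phases v M (F : nat -> nat) :
  (\sum_(offset r v <= t < phase_start r v M) F t =
   \sum_(j < M)
     \sum_(phase_start r v j <= t < phase_start r v j + phase_len r) F t)%N.
Proof.
elim: M => [|M IH].
  by rewrite big_ord0 big_geq // /phase_start; lia.
rewrite big_ord_recr -IH /=.
have e : phase_start r v M.+1 = (phase_start r v M + phase_len r)%N.
  by rewrite /phase_start mulSn; lia.
by rewrite e -big_cat_nat //= /phase_start; lia.
Qed.

Hypothesis T_gt0 : (0 < phase_len r)%N.

Lemma phase_end_le_horizon v j : (j < num_phases r v)%N ->
  (phase_start r v j + phase_len r <= horizon r)%N.
Proof.
rewrite /num_phases leq_divRL // mulSn /phase_start => h.
(* Subtraction is truncated, so this is what places the offset before the horizon. *)
have : (0 < horizon r - offset r v)%N.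
  by apply: leq_trans h; rewrite addn_gt0 T_gt0.
by lia.
Qed.

Lemma sum_phases_le v (F : nat -> nat) :
  (\sum_(j < num_phases r v)
     \sum_(phase_start r v j <= t < phase_start r v j + phase_len r) F t
   <= \sum_(t < horizon r) F t)%N.
Proof.
rewrite -sum_phases -(big_mkord xpredT F).
have [->|] := posnP (num_phases r v).
  by rewrite big_geq // /phase_start mul0n addn0.
case e: (num_phases r v) => [//|M] _.
have h : (phase_start r v M.+1 <= horizon r)%N.
  have := @phase_end_le_horizon v M; rewrite e => /(_ (ltnSn _)).
  by rewrite /phase_start mulSn; lia.
have ho : (offset r v <= phase_start r v M.+1)%N by rewrite /phase_start; lia.
rewrite [leqRHS](big_cat_nat (leq0n (offset r v))) /=;
  last exact: leq_trans ho h.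
rewrite [X in (_ <= _ + X)%N](big_cat_nat ho h) /=; lia.
Qed.

Lemma cell_phase v j t : in_phase v j t -> cell v t = j.+1.
Proof.
rewrite /in_phase /phase_start /cell => /andP[h1 h2].
have -> : (t + phase_len r - offset r v =
  j.+1 * phase_len r + (t - (offset r v + j * phase_len r)))%N by lia.
by rewrite divnMDl // divn_small ?addn0 //; lia.
Qed.

Hypothesis offset_lt : forall v, (offset r v < phase_len r)%N.

(** Fewer than T steps separate [t] from the start of the phase, so the quotient grows by at most
    one; an offset below T keeps the subtractions exact. *)
Lemma meets_cell v u j t : in_phase u j t -> meets v u j (cell v t).
Proof.
rewrite /in_phase /meets /cell.
set s := phase_start r u j; set T := phase_len r.
move=> /andP[h1 h2]; have := offset_lt v; rewrite -/T => ho.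
set x := (s + T - offset r v)%N; set y := (t + T - offset r v)%N.
have h3 : (x %/ T <= y %/ T)%N by apply: leq_div2r; rewrite /x /y; lia.
have h4 : (y %/ T <= (x + T) %/ T)%N by apply: leq_div2r; rewrite /x /y; lia.
move: h4; rewrite divnDr ?dvdnn // divnn T_gt0 addn1 => h4.
by lia.
Qed.

(** Fewer than T steps precede the first phase and fewer than T follow the last complete one. *)
Lemma horizon_le v : (0 < num_phases r v)%N ->
  (horizon r <= 3 * (num_phases r v * phase_len r))%N.
Proof.
move=> N0; have := offset_lt v.
have := ltn_ceil (horizon r - offset r v) T_gt0.
rewrite -/(num_phases r v) mulSn.
have := leq_pmull (phase_len r) N0; lia.
Qed.

End Timing.

(** * Regret and successes in terms of won, lost and blocked phases *)

Section Regret.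
Variables (R : realFieldType) (V : finType) (b : conflict_graph R V).
Variables (delta : R) (r : run V).
Implicit Types (u v : V) (L : {set V}) (t j : nat).

Definition open_step v t : bool :=
  ~~ jammed r v t && interference_ok b (transmitting r t) v.

(* For a silent link this counts the steps that would succeed if it sent:
   since b_v(v) = 0, its own transmission does not matter. *)
Definition good v j : bool :=
  delta / 2 <=
    (\sum_(phase_start r v j <= t < phase_start r v j + phase_len r)
       open_step v t)%N%:R / (phase_len r)%:R.

Definition won v := (\sum_(j < num_phases r v) (send r v j && good v j))%N.

Definition lost v := (\sum_(j < num_phases r v) (send r v j && ~~ good v j))%N.

Definition blocked v :=
  (\sum_(j < num_phases r v) (~~ send r v j && ~~ good v j))%N.

Lemma sendsE v : sends r v = (won v + lost v)%N.
Proof.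
rewrite -big_split /=; apply: eq_bigr => j _.
by case: (send _ _ _); case: (good _ _).
Qed.

Lemma interference_ok_setU1 L v :
  interference_ok b (v |: L) v = interference_ok b L v.
Proof.
rewrite /interference_ok; congr (_ <= _).
rewrite [LHS](bigID (pred1 v)) [RHS](bigID (pred1 v)) /=.
rewrite big1 ?[X in _ = X + _]big1; first last.
- by move=> u /andP[_ /eqP->]; rewrite weight_loop.
- by move=> u /andP[_ /eqP->]; rewrite weight_loop.
congr (_ + _); apply: eq_bigl => u; rewrite !inE.
by case: (u == v); rewrite ?andbF.
Qed.

Lemma optimum_is_feasible t :
  exists2 L, feasible b L & optimum b r t = #|L|.
Proof.
rewrite /optimum.
have [|L /forall_inP hL ->] := @eq_bigmax_cond _
    (fun L => [forall v in L, succeeds b r L v t]) (fun L => #|L|).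
  by apply/card_gt0P; exists set0; apply/forall_inP => v; rewrite inE.
by exists L => //; apply/forall_inP => v /hL /and3P[].
Qed.

Lemma succeeds_send v j t :
  (j < num_phases r v)%N -> send r v j -> in_phase r v j t ->
  succeeds b r (transmitting r t) v t = open_step v t.
Proof. by move=> jN sj tj; rewrite /succeeds (mem_transmitting jN sj tj). Qed.

Lemma utilityE v j : (j < num_phases r v)%N ->
  utility b delta r v j = if send r v j then if good v j then 1 else -1 else 0.
Proof.
move=> jN; rewrite /utility; case: ifP => // sj.
rewrite /good /success_fraction; congr (if _ <= _%:R / _ then _ else _).
by apply: eq_big_nat => t tj; rewrite (succeeds_send jN sj tj).
Qed.

Lemma utility_deviate_send v j : (j < num_phases r v)%N ->
  utility b delta (deviate r v j true) v j = if good v j then 1 else -1.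
Proof.
move=> jN; rewrite /utility /= !eqxx /= /good /success_fraction.
congr (if _ <= _%:R / _ then _ else _).
apply: eq_big_nat => t tj; rewrite (transmitting_deviate jN tj).
by rewrite /succeeds setU11 interference_ok_setU1.
Qed.

Lemma utility_deviate_silent v j :
  utility b delta (deviate r v j false) v j = 0.
Proof. by rewrite /utility /= !eqxx. Qed.

(** The first bound compares with always sending, the second with never sending. *)
Lemma average_regret_bounds v eps : (0 < num_phases r v)%N ->
  average_regret b delta r v <= eps ->
  ((1 - eps) * (num_phases r v)%:R <= (sends r v + 2 * blocked v)%N%:R) /\
  ((lost v)%:R <= (won v)%:R + eps * (num_phases r v)%:R).
Proof.
move=> N0; rewrite /average_regret ler_pdivrMr ?ltr0n // lerBlDr ge_max.
under eq_bigr => j _ do rewrite utility_deviate_send ?ltn_ord //.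
under [X in _ && (X <= _)]eq_bigr => j _ do rewrite utility_deviate_silent.
rewrite big1_eq.
under [X in _ <= _ + X]eq_bigr => j _ do rewrite utilityE ?ltn_ord //.
under [X in _ && (_ <= _ + X)]eq_bigr => j _ do rewrite utilityE ?ltn_ord //.
have -> : \sum_(j < num_phases r v)
    (if send r v j then if good v j then 1 else -1 else 0) =
    (won v)%:R - (lost v)%:R :> R.
  rewrite !natr_sum -sumrB; apply: eq_bigr => j _.
  by case: (send _ _ _); case: (good _ _); rewrite /= ?subr0 ?sub0r.
(* A phase that is not good is lost or blocked, and costs 2 relative to a good one. *)
have -> : \sum_(j < num_phases r v) (if good v j then 1 else -1) =
    (num_phases r v)%:R - 2 * (lost v)%:R - 2 * (blocked v)%:R :> R.
  rewrite -[X in _ = X%:R - _ - _]card_ord -sumr_const !natr_sum.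
  rewrite !mulr_sumr -!sumrB.
  apply: eq_bigr => j _.
  by case: (send _ _ _); case: (good _ _) => /=; lra.
rewrite natrD natrM sendsE natrD; move=> /andP[h1 h2]; split; lra.
Qed.

Hypothesis T_gt0 : (0 < phase_len r)%N.

Lemma successes_ge :
  delta / 2 * (phase_len r)%:R * (\sum_u won u)%N%:R <=
  (\sum_(t < horizon r) #|[set v | succeeds b r (transmitting r t) v t]|)%N%:R.
Proof.
have -> : (\sum_(t < horizon r)
      #|[set v | succeeds b r (transmitting r t) v t]|)%N =
    (\sum_v \sum_(t < horizon r) succeeds b r (transmitting r t) v t)%N.
  rewrite exchange_big /=; apply: eq_bigr => t _.
  rewrite -sum1_card big_mkcond; apply: eq_bigr => v _.
  by rewrite inE; case: succeeds.
rewrite !natr_sum mulr_sumr; apply: ler_sum => v _.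
apply: le_trans (_ : _ <= (\sum_(j < num_phases r v)
     \sum_(phase_start r v j <= t < phase_start r v j + phase_len r)
        succeeds b r (transmitting r t) v t)%N%:R) _; last first.
  rewrite ler_nat.
  exact: (sum_phases_le T_gt0 v (fun t => succeeds b r (transmitting r t) v t)).
rewrite /won !natr_sum mulr_sumr; apply: ler_sum => j _.
have [/andP[sj]|_] := boolP (_ && _); last by rewrite mulr0.
rewrite mulr1 /good ler_pdivlMr ?ltr0n // => h; apply: le_trans h _.
rewrite ler_nat; apply: eq_leq; apply: eq_big_nat => t tj.
by rewrite (succeeds_send (ltn_ord j) sj tj).
Qed.

(** * Charging failures to interfering transmissions *)

Hypothesis delta_ge0 : 0 <= delta.
Hypothesis adv : bounded_adversary (phase_len r) delta r.

(** Otherwise only jamming closes steps, which leaves a fraction [delta] open, no less than the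
    threshold [delta / 2]. *)
Lemma bad_interfered v j : (j < num_phases r v)%N -> ~~ good v j ->
  exists2 t, in_phase r v j t & ~~ interference_ok b (transmitting r t) v.
Proof.
move=> jN; set s := phase_start r v j; set T := phase_len r.
have [/existsP[i hi] _|/existsPn nex] :=
    boolP [exists i : 'I_T, ~~ interference_ok b (transmitting r (s + i)) v].
  by exists (s + i)%N; rewrite // /in_phase leq_addr ltn_add2l /=.
case/negP; rewrite /good -/s -/T.
have TR : 0 < T%:R :> R by rewrite ltr0n.
have hadv := adv v (leqnn T) (phase_end_le_horizon T_gt0 jN).
rewrite ler_pdivlMr //.
have -> : (\sum_(s <= t < s + T) open_step v t)%N =
   (T - \sum_(s <= t < s + T) jammed r v t)%N.
  have eT : (\sum_(s <= t < s + T) 1)%N = T by rewrite sum_nat_const_nat; lia.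
  rewrite -[X in (X - _)%N]eT.
  rewrite -sumnB; last by move=> t _; case: jammed.
  apply: eq_big_nat => t /andP[st tT].
  have lt : (t - s < T)%N by lia.
  have := nex (Ordinal lt); rewrite /= subnKC // negbK /open_step => ->.
  by case: jammed.
rewrite natrB; last first.
  apply: (@leq_trans (\sum_(s <= t < s + T) 1)).
    by apply: leq_sum => t _; case: jammed.
  by rewrite sum_nat_const_nat; lia.
have : 0 <= delta * T%:R by rewrite mulr_ge0 // ltW.
by move: hadv; rewrite -/s -/T; lra.
Qed.

Lemma lost_collides v j : (j < num_phases r v)%N -> ~~ good v j ->
  exists t u, [/\ in_phase r v j t, u != v & u \in transmitting r t].
Proof.
move=> jN bad; have [t tj ni] := bad_interfered jN bad.
exists t; have [/existsP[u /andP[uv ut]]|/existsPn h] :=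
  boolP [exists u, (u != v) && (u \in transmitting r t)]; first by exists u.
case/negP: ni; rewrite /interference_ok big1 // => u ut.
by have := h u; rewrite ut andbT negbK => /eqP->; rewrite weight_loop.
Qed.

Hypothesis offset_lt : forall v, (offset r v < phase_len r)%N.

(** A blocked phase has a step with interference above 1, paid for by sending phases that meet its
    cell. Each phase of [u] pays [b u v] to at most two cells. *)
Lemma blocked_le v :
  (blocked v)%:R <= 2 * \sum_u b u v * (sends r u)%:R :> R.
Proof.
have -> : 2 * \sum_u b u v * (sends r u)%:R =
    \sum_u \sum_(j < num_phases r u | send r u j) b u v * 2%:R.
  rewrite mulr_sumr; apply: eq_bigr => u _.
  rewrite /sends natr_sum [in RHS]big_mkcond mulr_sumr mulr_sumr.
  by apply: eq_bigr => j _; case: send; rewrite ?mulr1 ?mulr0 //; lra.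
apply: (@le_trans _ _ (\sum_u \sum_(j < num_phases r u | send r u j)
   \sum_(i < num_phases r v) b u v * (meets r v u j i.+1)%:R)); last first.
  apply: ler_sum => u _; apply: ler_sum => j _; rewrite -mulr_sumr.
  apply: ler_wpM2l; first exact: weight_ge0.
  rewrite -natr_sum ler_nat.
  apply: leq_trans (sum_meets r v u j (num_phases r v) (fun=> 1%N)).
  by apply: leq_sum => i _; rewrite muln1.
under eq_bigr => u _ do rewrite exchange_big.
rewrite exchange_big /= /blocked natr_sum; apply: ler_sum => i _.
have ge0 u (P : pred 'I_(num_phases r u)) :
    0 <= \sum_(j | P j) b u v * (meets r v u j i.+1)%:R.
  by apply: sumr_ge0 => j _; rewrite mulr_ge0 ?weight_ge0.
have [/andP[_ bad]|_] := boolP (_ && _);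
  last by apply: sumr_ge0 => u _; exact: ge0.
have [t ti] := bad_interfered (ltn_ord i) bad.
rewrite /interference_ok -ltNge => /ltW h; apply: le_trans h _.
rewrite big_mkcond; apply: ler_sum => u _; case: ifP => [|_]; last exact: ge0.
case/transmittingP=> j sj tj.
rewrite (bigD1 j) //= -(cell_phase T_gt0 ti).
rewrite (meets_cell T_gt0 offset_lt v tj) mulr1.
by rewrite lerDl (cell_phase T_gt0 ti) ge0.
Qed.

(* Each phase of [v] in use hands out two units to the transmissions meeting
   it; a lost transmission shares one of its two cells and so gets at most 3. *)
Lemma busy_le v :
  (2 * (sends r v + blocked v) <= 4 * (\sum_u won u) + 3 * (\sum_u lost u))%N.
Proof.
(* A sole visitor of a cell receives both units, several visitors one each, so [load * f] is at
   least 2 on every cell in use. *)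
pose f (p : nat) := ((load r v p == 1) + 1)%N.
apply: (@leq_trans (\sum_(i < num_phases r v) load r v i.+1 * f i.+1)).
  rewrite -big_split big_distrr /=; apply: leq_sum => i _.
  suff : send r v i || ~~ good v i -> (0 < load r v i.+1)%N.
    rewrite /f; case: (load _ _) => [|[|k]];
      case: (send _ _ _); case: (good _ _); move=> h //=;
      try (have := h isT); lia.
  move=> h; case sv: (send r v i).
    apply: (load_ge1 sv).
    have ti : in_phase r v i (phase_start r v i).
      by rewrite /in_phase leqnn /=; lia.
    by rewrite -(cell_phase T_gt0 ti) meets_cell.
  move: h; rewrite sv /= => bad.
  have [t [u [ti uv /transmittingP[j sj tj]]]] := lost_collides (ltn_ord i) bad.
  by apply: (load_ge1 sj); rewrite -(cell_phase T_gt0 ti) meets_cell.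
have -> : (\sum_(i < num_phases r v) load r v i.+1 * f i.+1 =
   \sum_u \sum_(j < num_phases r u | send r u j)
   \sum_(i < num_phases r v) meets r v u j i.+1 * f i.+1)%N.
  under [LHS]eq_bigr => i _ do rewrite [load r v i.+1]/load big_distrl /=.
  rewrite exchange_big /=; apply: eq_bigr => u _.
  under eq_bigr => i _ do rewrite big_distrl /=.
  by rewrite exchange_big.
rewrite !big_distrr -big_split /=; apply: leq_sum => u _.
rewrite !big_distrr -big_split big_mkcond /=; apply: leq_sum => j _.
case sj: (send r u j) => //=.
apply: leq_trans (sum_meets _ _ _ _ _ _) _; set p := cell _ _.
have [_|bad] := boolP (good u j); first by rewrite /f; do 2 case: eqP.
have [t [w [tj wu /transmittingP[k sk tk]]]] := lost_collides (ltn_ord j) bad.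
have mk := meets_cell T_gt0 offset_lt v tk.
have mj := meets_cell T_gt0 offset_lt v tj.
(* The cell at the collision has load at least 2, so its share is 1; the other share is at most
   2. *)
have := load_ge2 wu sk sj mk mj; move: mj; rewrite /meets -/p /f.
by case/orP=> /eqP-> h; rewrite (gtn_eqF h); case: (_ == 1%N).
Qed.

(** * Consequences of low regret for all links *)

Variable eps : R.
Hypothesis N_gt0 : forall v, (0 < num_phases r v)%N.
Hypothesis eps_le : eps <= (4 * #|V|)%N%:R^-1.
Hypothesis regret_le : forall v, average_regret b delta r v <= eps.

(** The n regret terms are each at most N/(4n), hence N/4 in total. *)
Lemma sum_lost_le v : (forall u, num_phases r u <= num_phases r v)%N ->
  (4 * \sum_u lost u <= 4 * (\sum_u won u) + num_phases r v)%N.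
Proof.
move=> vmax; rewrite -(ler_nat R) natrD !natrM.
have nV : (0 < #|V|)%N by apply/card_gt0P; exists v.
have -> : (num_phases r v)%:R =
    4 * \sum_(u : V) (4 * #|V|)%N%:R^-1 * (num_phases r v)%:R :> R.
  rewrite sumr_const -mulr_natr natrM.
  have : #|V|%:R != 0 :> R by rewrite pnatr_eq0 -lt0n.
  by move=> ?; field.
rewrite -mulrDr ler_wpM2l // !natr_sum -big_split /=; apply: ler_sum => u _.
have [_ h] := average_regret_bounds (N_gt0 u) (regret_le u).
apply: le_trans h _.
rewrite lerD2l; apply: le_trans (ler_wpM2r _ eps_le) _ => //.
by rewrite ler_wpM2l ?invr_ge0 // ler_nat.
Qed.

Lemma num_phases_le_won v : (forall u, num_phases r u <= num_phases r v)%N ->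
  (num_phases r v <= 56 * \sum_u won u)%N.
Proof.
move=> vmax; rewrite -(ler_nat R).
have [h _] := average_regret_bounds (N_gt0 v) (regret_le v).
have {}h : (1 - eps) * (num_phases r v)%:R <=
    (4 * (\sum_u won u) + 3 * \sum_u lost u)%N%:R.
  apply: le_trans h _; rewrite ler_nat.
  by apply: leq_trans (busy_le v); lia.
have nV : (0 < #|V|)%N by apply/card_gt0P; exists v.
(* With [eps] = 1/4 the terms in N would cancel. A single link never loses, and two or more give
   [eps] at most 1/8, so that 7N/8 <= 7G + 3N/4. *)
have [V1|V2] := leqP #|V| 1.
  have L0 : (\sum_u lost u = 0)%N.
    apply: big1 => u _; apply: big1 => j _.
    have [/andP[_ bad]|//] := boolP (_ && _).
    have [t [w [_ wu _]]] := lost_collides (ltn_ord j) bad.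
    by rewrite (fintype_le1P V1 u w) eqxx in wu.
  have V1' : #|V| = 1 by apply/eqP; rewrite eqn_leq V1.
  have : eps * (num_phases r v)%:R <= 4^-1 * (num_phases r v)%:R.
    by rewrite ler_wpM2r // (le_trans eps_le) // V1'.
  have := ler0n R (\sum_u won u).
  by move: h; rewrite L0 addn0 !natrM; lra.
have : eps * (num_phases r v)%:R <= 8^-1 * (num_phases r v)%:R.
  rewrite ler_wpM2r // (le_trans eps_le) // lef_pV2 ?posrE ?ltr0n ?ler_nat; lia.
have := sum_lost_le vmax; rewrite -(ler_nat R).
move: h; rewrite !(natrD _ _ (3 * _)) (natrD _ _ (num_phases _ _)) !natrM.
by lra.
Qed.

(** The factor is 2 + 56/4, from X <= 2G + N/4 and N <= 56G. *)
Lemma sends_le_won : (\sum_u sends r u <= 16 * \sum_u won u)%N.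
Proof.
have [V0|/card_gt0P[v0 _]] := posnP #|V|.
  rewrite big1 // => u _; have : (0 < #|V|)%N by apply/card_gt0P; exists u.
  by rewrite V0.
have [v _ vmax] := arg_maxnP (num_phases r) (isT : xpredT v0).
have := sum_lost_le (fun u => vmax u isT).
have := num_phases_le_won (fun u => vmax u isT).
rewrite (eq_bigr _ (fun u _ => sendsE u)) big_split /=; lia.
Qed.

Lemma horizon_le_sends_blocked v :
  (horizon r)%:R <=
    4 * (phase_len r)%:R * (sends r v + 2 * blocked v)%N%:R :> R.
Proof.
have [h _] := average_regret_bounds (N_gt0 v) (regret_le v).
have := horizon_le T_gt0 offset_lt (N_gt0 v); rewrite -(ler_nat R) !natrM => hH.
have nV : (0 < #|V|)%N by apply/card_gt0P; exists v.
have e4 : eps * (num_phases r v)%:R <= 4^-1 * (num_phases r v)%:R.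
  rewrite ler_wpM2r // (le_trans eps_le) //.
  by rewrite lef_pV2 ?posrE ?ltr0n ?ler_nat; lia.
have {}h : 3 / 4 * (num_phases r v)%:R <= (sends r v + 2 * blocked v)%N%:R :> R.
  by lra.
have := ler_wpM2r (ler0n R (phase_len r)) h; lra.
Qed.

(** Summed over the independent subset, the blocked phases are bounded by exchanging sums: each
    sending phase of [u] counts with total weight at most [C]. The factor 64 is 4 * 16. *)
Lemma feasible_card_le_won C c (O : {set V}) :
  C_independent b C c -> feasible b O ->
  c * #|O|%:R * (horizon r)%:R <=
  64 * (1 + 4 * `|C|) * (phase_len r)%:R * (\sum_u won u)%N%:R.
Proof.
move=> indep /indep[O' [_ cO' bO']].
apply: le_trans (ler_wpM2r (ler0n _ _) cO') _.
rewrite [leLHS](_ : _ = \sum_(v in O') (horizon r)%:R); last first.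
  by rewrite sumr_const mulr_natl.
apply: le_trans (_ : _ <= \sum_(v in O') 4 * (phase_len r)%:R *
    (sends r v + 2 * blocked v)%N%:R) _.
  by apply: ler_sum => v _; exact: horizon_le_sends_blocked.
rewrite -mulr_sumr.
have X : \sum_(v in O') (sends r v + 2 * blocked v)%N%:R <=
    (1 + 4 * `|C|) * (\sum_u sends r u)%N%:R :> R.
  apply: le_trans (_ : _ <= \sum_(v in O')
      ((sends r v)%:R + 4 * \sum_u b u v * (sends r u)%:R)) _.
    apply: ler_sum => v _; rewrite natrD natrM lerD2l.
    have := blocked_le v; lra.
  rewrite big_split mulrDl mul1r /=; apply: lerD.
    rewrite natr_sum [leRHS](bigID (mem O')) /= lerDl.
    exact: sumr_ge0.
  rewrite -mulr_sumr -mulrA ler_wpM2l // exchange_big natr_sum mulr_sumr /=.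
  apply: ler_sum => u _; rewrite -mulr_suml ler_wpM2r //.
  exact: le_trans (bO' u) (ler_norm C).
have T0 : 0 <= 4 * (phase_len r)%:R :> R by rewrite mulr_ge0.
apply: le_trans (ler_wpM2l T0 X) _.
have := sends_le_won; rewrite -(ler_nat R) natrM => hS.
have K0 : 0 <= 4 * (phase_len r)%:R * (1 + 4 * `|C|) :> R.
  by rewrite mulr_ge0 // addr_ge0 // mulr_ge0.
have := ler_wpM2l K0 hS; lra.
Qed.

End Regret.

Theorem theorem2 (R : realFieldType) (C c : R) (c_gt0 : 0 < c) :
  exists2 K : R, 0 < K &
    forall (V : finType) (b : conflict_graph R V)
      (T' : nat) (delta eps : R) (r : run V),
      C_independent b C c ->
      (0 < T')%N -> 0 < delta -> delta <= 1 ->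
      phase_len r = T' ->
      (forall i : V, (offset r i < phase_len r)%N) ->
      (forall i : V, (0 < num_phases r i)%N) ->
      bounded_adversary T' delta r ->
      eps <= (4 * #|V|)%N%:R^-1 ->
      (forall i : V, average_regret b delta r i <= eps) ->
      average_optimum b r <= K / delta * average_successes b r.
Proof.
have C1 : 0 < 1 + 4 * `|C| by rewrite ltr_wpDr // mulr_ge0.
(* The factor 64 doubles because a won phase only guarantees a fraction [delta / 2] of successes. *)
exists (128 * (1 + 4 * `|C|) / c); first by rewrite divr_gt0 // mulr_gt0.
move=> V b T' delta eps r indep T0 d0 _ eT ho hN adv he hr.
rewrite -eT in T0 adv.
have hopt t : (optimum b r t)%:R * (horizon r)%:R <=
    128 * (1 + 4 * `|C|) / c / delta *
    (\sum_(t < horizon r)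
       #|[set v | succeeds b r (transmitting r t) v t]|)%N%:R.
  have [L fL ->] := optimum_is_feasible b r t.
  have h1 := feasible_card_le_won T0 (ltW d0) adv ho hN he hr indep fL.
  have h2 := successes_ge b delta T0.
  have h3 : 0 <= 128 * (1 + 4 * `|C|) / c / delta.
    by rewrite !divr_ge0 // ?mulr_ge0 // ltW.
  apply: le_trans _ (ler_wpM2l h3 h2).
  rewrite -(ler_pM2l c_gt0) [leLHS]mulrA; apply: le_trans h1 _.
  rewrite le_eqVlt; apply/orP; left; apply/eqP.
  by field; rewrite !gt_eqF.
rewrite /average_optimum /average_successes mulrA ler_wpM2r ?invr_ge0 //.
have [H0|H0] := posnP (horizon r).
  by rewrite H0 !big_ord0 mulr0.
rewrite -(ler_pM2r (_ : 0 < (horizon r)%:R :> R)) ?ltr0n //.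
rewrite natr_sum mulr_suml.
apply: le_trans (ler_sum _ (fun (t : 'I_(horizon r)) _ => hopt t)) _.
by rewrite sumr_const card_ord -[leLHS]mulr_natr.
Qed.
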